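(* Let $\alpha>0$ and let $\mathcal{G}_\alpha$ be the Gamma random variable with density $p_{\mathcal{G}_\alpha}(x)=\frac1{\Gamma(\alpha)}x^{\alpha-1}e^{-x}$ for $x>0$ and $p_{\mathcal{G}_\alpha}(x)=0$ for $x\le0$. Then $$p_{\mathcal{G}_\alpha}(x)=\begin{cases}\mathbb{E}\Big[\mathbf 1_{\{\mathcal{G}_\alpha>x\}}\Big(1+\frac{1-\alpha}{\mathcal{G}_\alpha}\Big)\Big], & x\in(0,\infty),\\[4pt] \mathbb{E}\Big[\mathbf 1_{\{\mathcal{G}_\alpha<x\}}\Big(1+\frac{1-\alpha}{\mathcal{G}_\alpha}\Big)\Big], & x\in(-\infty,0].\end{cases}$$ In addition, for any integer $k\ge1$, the $k$-th derivative of the density function of $\mathcal{G}_\alpha$ admits the representation $$p^{(k)}_{\mathcal{G}_\alpha}(x)=\begin{cases}\mathbb{E}\big[\mathbf 1_{\{\mathcal{G}_\alpha>x\}}\nu_{k+1}(\mathcal{G}_\alpha)\big], & x\in(0,\infty),\\ \mathbb{E}\big[\mathbf 1_{\{\mathcal{G}_\alpha<x\}}\nu_{k+1}(\mathcal{G}_\alpha)\big], & x\in(-\infty,0),\end{cases}$$ where $$\nu_k(y):=\begin{cases}(-1)^{k-1}\sum_{i=0}^{k}\binom ki\prod_{j=1}^i(j-\alpha)\,\frac1{y^i}, & y\ne0,\\ 0,& y=0.\end{cases}$$ Furthermore, when $x=0$ and $\alpha>k+1$, we have $p^{(k)}_{\mathcal{G}_\alpha}(0)=\mathbb{E}\big[\mathbf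 1_{\{\mathcal{G}_\alpha<0\}}\nu_{k+1}(\mathcal{G}_\alpha)\big]=0$.
   Context: Empty products are equal to $1$ (i.e. $\prod_{j=1}^0(j-\alpha)=1$). $\Gamma(\alpha)$ is the Gamma function. *)

(* Defs.v *)
From HB Require Import structures.
From mathcomp Require Import all_boot all_order all_algebra.
From mathcomp Require Import all_classical all_reals all_analysis.

Set Implicit Arguments.
Unset Strict Implicit.
Unset Printing Implicit Defensive.

Import Order.TTheory GRing.Theory Num.Theory.
Import numFieldNormedType.Exports.

Local Open Scope classical_set_scope.
Local Open Scope ring_scope.

Definition has_density d (T : measurableType d) (R : realType)
    (P : probability T R) (X : {RV P >-> R}) (p : R -> R) : Prop :=
  forall A : set R, measurable A ->
    distribution P X A = (\int[lebesgue_measure]_(x in A) (p x)%:E)%E.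

Definition Gamma (R : realType) (a : R) : R :=
  Rintegral lebesgue_measure `]0, +oo[ (fun t : R => t `^ (a - 1) * expR (- t)).

Definition gamma_pdf (R : realType) (a x : R) : R :=
  if 0 < x then (Gamma a)^-1 * x `^ (a - 1) * expR (- x) else 0.

(* Meaningful for 1 <= k only: the exponent k.-1 is truncated at k = 0. *)
Definition nu (R : realType) (a : R) (k : nat) (y : R) : R :=
  if y == 0 then 0
  else (-1) ^+ k.-1 *
       \sum_(0 <= i < k.+1)
         'C(k, i)%:R * (\prod_(1 <= j < i.+1) (j%:R - a)) * (y ^+ i)^-1.

(* Main.v *)
Require Import Defs.
From HB Require Import structures.
From mathcomp Require Import all_boot all_order all_algebra.
From mathcomp Require Import all_classical all_reals all_analysis.
From mathcomp Require Import measurable_realfun.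
From mathcomp Require Import ring lra.

Import Order.TTheory GRing.Theory Num.Theory.
Import numFieldNormedType.Exports.

Local Open Scope classical_set_scope.
Local Open Scope ring_scope.

(** The density p of the Gamma law vanishes at infinity together with all its
    derivatives, so the fundamental theorem of calculus gives
      p^(k)(x) = - \int_x^oo p^(k+1)(y) dy   for x > 0.
    On the positive half-line p satisfies the logarithmic equation
    p'(y) = p(y) ((a - 1) / y - 1); hence every derivative has the form
    p^(k)(y) = p(y) q_k(1/y) for polynomials q_k obeying
    q_(k+1) = ((a - 1) X - 1) q_k - X^2 q_k', and Pascal's rule identifies
    the coefficients of - q_k with those of nu_k ([gamma_polyS], [nuE]). The
    right-hand side is therefore the integral of p(y) nu_(k+1)(y) over
    ]x, +oo[, which is an expectation because p is the density of G
    ([expectation_gamma_upper]). For k = 0 this is the formula for p itself,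
    as nu_1(y) = 1 + (1 - a) / y.

    For x <= 0 the event G < x is null, so the expectations vanish, and so do p
    and its derivatives on the negative half-line. At the origin, p^(j)(y) is
    O(y^(a - 1 - j)) as y decreases to 0, so its difference quotient tends to
    0 as long as j + 2 < a; [derive1n_gamma_pdf0] climbs from j to j + 1 in this
    way, up to order k when k + 1 < a.

    Integrability comes from the law itself: p has total mass 1, being the
    density of a probability, and q_(k+1)(1/y) is bounded on [x, +oo[. *)

(** * Integration over unbounded intervals and against a density *)

(** As f may change sign, its integral is not a supremum of integrals over
    compact intervals; integrability makes it their limit. *)
Lemma integrable_continuous_FTC2y {R : realType} (f F : R -> R) (a l : R) :
  (@lebesgue_measure R).-integrable `[a, +oo[ (EFin \o f) ->
  {within `[a, +oo[, continuous f} ->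
  F x @[x --> +oo] --> l ->
  (forall x, a <= x -> is_derive x 1 F (f x)) ->
  (\int[lebesgue_measure]_(x in `[a, +oo[) (f x)%:E = l%:E - (F a)%:E)%E.
Proof.
move=> intf cf Fl dF.
(* The truncations of f to compact intervals, to which the compact version of
   the theorem and dominated convergence both apply. *)
pose f_ n := (EFin \o f) \_ `[a, a + n.+1%:R].
have f_E n : (\int[lebesgue_measure]_(x in `[a, +oo[) f_ n x =
    (F (a + n.+1%:R))%:E - (F a)%:E)%E.
  rewrite -integral_mkcondr setIidr; last first.
    by apply: subset_itvl.
  apply: continuous_FTC2.
  - by rewrite ltrDl.
  - by apply: continuous_subspaceW cf; exact: subset_itvl.
  - have cF x : a <= x -> {for x, continuous F}.
      move=> ax; apply/differentiable_continuous/derivable1_diffP.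
      by have [] := dF _ ax.
    split.
    + by move=> x; rewrite in_itv/= => /andP[/ltW/dF[]].
    + by apply: cvg_at_right_filter; exact: cF.
    + by apply: cvg_at_left_filter; apply: cF; rewrite lerDl.
  - move=> x; rewrite in_itv/= => /andP[/ltW ax _].
    by rewrite derive1E; have [_ ->] := dF _ ax.
have mf := measurable_int _ intf.
case: (@dominated_convergence _ _ _ lebesgue_measure `[a, +oo[ _ f_
  (EFin \o f) (abse \o EFin \o f)) => //.
- move=> n; apply/measurable_restrict => //=.
  by apply: measurable_funS mf => //; exact: subIsetr.
- apply: aeW => x; rewrite /= in_itv/= andbT => ax.
  apply: cvg_near_cst; near=> n.
  rewrite /f_ patchE mem_set//= in_itv/= ax/= -lerBlDl.
  rewrite (@le_trans _ _ n%:R)// ?ler_nat//.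
  by near: n; exact: nbhs_infty_ger.
- exact: integrable_abse.
- apply: aeW => x n _; rewrite /f_ patchE; case: ifPn => //= _.
  by rewrite lee_fin normr0.
move=> _ _; rewrite /= (funext f_E) => cvg_int.
have Fn : F (a + n.+1%:R) @[n --> \oo] --> l.
  apply: (cvg_pinftyP _ _).1 Fl _ _.
  apply/cvgryPge => r; near=> n.
  rewrite -lerBlDl (@le_trans _ _ n%:R)// ?ler_nat//.
  by near: n; exact: nbhs_infty_ger.
apply: (cvg_unique _ cvg_int) => //=.
apply: cvg_EFin; first exact: nearW.
exact: cvgB Fn (cvg_cst _).
Unshelve. all: by end_near. Qed.

Section density.
Context d (T : measurableType d) (R : realType).
Context (P : probability T R) (X : {RV P >-> R}) (p : R -> R).
Hypothesis (p_ge0 : forall x, 0 <= p x) (mp : measurable_fun [set: R] p).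
Hypothesis (Xp : has_density X p).
Local Notation mu := (@lebesgue_measure R).

(** X and its law, seen on the copy of R that carries the Lebesgue measure:
    Radon-Nikodym derivatives relate two measures on the same measurable
    type. *)
Let XR : T -> measurableTypeR R := X.

Let mXR : measurable_fun [set: T] XR.
Proof. exact: (measurable_funPT X). Qed.

HB.instance Definition _ :=
  isMeasurableFun.Build _ _ T (measurableTypeR R) XR mXR.

Let law : probability (measurableTypeR R) R := distribution P XR.

Lemma density_integrable : mu.-integrable [set: R] (EFin \o p).
Proof.
apply/integrableP; split; first exact/measurable_EFinP.
under eq_integral do rewrite /= ger0_norm//.
by rewrite -(Xp _ measurableT) probability_setT ltry.
Qed.

Let law_mu : law `<< mu.
Proof.
apply/null_content_dominatesP => A mA muA0; rewrite [LHS](Xp _ mA).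
by apply: null_set_integral => //; exact/measurable_funTS/measurable_EFinP.
Qed.

(** By uniqueness of the Radon-Nikodym derivative, p agrees almost everywhere
    with the derivative of the law of X. *)
Let integral_law (D : set R) (f : R -> \bar R) :
  measurable D -> law.-integrable D f ->
  (\int[law]_(x in D) f x =
   \int[mu]_(x in D) (f x * (p x)%:E))%E.
Proof.
move=> mD intf.
have int_dens : mu.-integrable setT
    (Radon_Nikodym (charge_of_finite_measure law) mu).
  exact: Radon_Nikodym_integrable.
have mpD : measurable_fun (D : set (measurableTypeR R)) (EFin \o p).
  exact/measurable_funTS/measurable_EFinP.
have mf := measurable_int _ intf.
rewrite -(Radon_Nikodym_change_of_variables law_mu)//.
apply: ae_eq_integral => //.
- apply: emeasurable_funM => //; apply: (measurable_int mu).
  exact: integrableS int_dens.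
- exact: emeasurable_funM.
- apply/ae_eqe_mul2l/integral_ae_eq => //=; first exact: integrableS int_dens.
  by move=> E _ mE; rewrite -Radon_Nikodym_integral//=; exact: Xp.
Qed.

(** Boundedness on D makes f integrable for the law of X, whatever happens to f
    outside of D; this is what allows f to have a pole there. *)
Lemma expectation_density (D : set R) (f : R -> R) :
  measurable D -> measurable_fun D f -> [bounded f x | x in D] ->
  ('E_P[fun w => (\1_(X @^-1` D) w * f (X w))%R] =
   \int[mu]_(x in D) (f x * p x)%:E)%E.
Proof.
move=> mD mf bf.
have mfD : measurable_fun [set: R] (f \_ D).
  exact/(measurable_restrictT f mD).
have bfD Q : [bounded (f \_ D) x | x in Q].
  (* The maximum accounts for the value 0 taken outside of D. *)
  case: bf => M [Mr Mf]; exists (Num.max M 0); split.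
    by rewrite realE; case: (leP 0 (Num.max M 0)) => // /ltW ->; rewrite orbT.
  move=> B; rewrite gt_max => /andP[MB B0] x _ /=; rewrite patchE.
  case: ifPn => [/set_mem Dx|_].
    exact: (Mf _ MB _ Dx).
  by rewrite normr0 ltW.
have -> : (fun w => (\1_(X @^-1` D) w * f (X w))%R) = (f \_ D) \o XR.
  apply/funext => w /=; rewrite patchE indicE -[w \in _]/(X w \in D).
  by case: ifPn; rewrite (mul1r,mul0r).
rewrite expectation.unlock.
rewrite -(integral_distribution (X := XR)
  (f := EFin \o (f \_ D)))//=; last 2 first.
- exact/measurable_EFinP.
- apply: measurable_bounded_integrable => //.
  + by rewrite (le_lt_trans (probability_le1 _ _))// ltry.
  + exact: measurableT_comp.
  + case: (bfD setT) => M [Mr Mf]; exists M; split=> // B MB w _.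
    exact: (Mf B MB).
rewrite -(@integral_law D (EFin \o f))//.
  rewrite [RHS]integral_mkcond; apply: eq_integral => x _.
  by rewrite restrict_EFin.
apply: measurable_bounded_integrable => //.
by rewrite (le_lt_trans (probability_le1 _ _))// ltry.
Qed.
End density.

(** * The polynomials governing the derivatives *)

Section gamma_poly.
Context {R : realType}.
Implicit Types (a x : R) (k : nat).

(** The polynomial q_k with p^(k)(x) = p(x) q_k(1/x); by Rodrigues'
    formula, q_k(1/x) is k! x^-k times the generalized Laguerre polynomial of
    degree k and parameter a - 1 - k at x. *)
Definition gamma_poly a k : {poly R} :=
  \poly_(i < k.+1)
    ((-1) ^+ k * 'C(k, i)%:R * \prod_(1 <= j < i.+1) (j%:R - a)).

Lemma coef_gamma_poly a k i : (gamma_poly a k)`_i =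
  (-1) ^+ k * 'C(k, i)%:R * \prod_(1 <= j < i.+1) (j%:R - a).
Proof.
rewrite coef_poly ltnS; case: leqP => // ki.
by rewrite bin_small// mulr0 mul0r.
Qed.

Lemma gamma_poly0 a : gamma_poly a 0 = 1.
Proof.
apply/polyP => i; rewrite coef_gamma_poly coef1 expr0 mul1r bin0n.
by case: i => [|i]; rewrite ?mul0r//= big_geq// mulr1.
Qed.

(** This is the derivative of p(x) q_k(1/x) divided by p(x). Coefficientwise, it
    is Pascal's rule: the terms of degree i + 1 coming from (a - 1) X q_k and
    from - X^2 q_k' combine into a - 1 - i times the coefficient of degree i,
    which extends the product by one factor. *)
Lemma gamma_polyS a k : gamma_poly a k.+1 =
  ((a - 1) *: 'X - 1) * gamma_poly a k - 'X ^+ 2 * (gamma_poly a k)^`().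
Proof.
apply/polyP => i; rewrite mulrBl mul1r -scalerAl !coefB coefZ coefXM.
rewrite expr2 -mulrA !coefXM !coef_gamma_poly.
case: i => [|i] /=; first by rewrite !bin0 exprS; ring.
rewrite binS natrD big_nat_recr//= exprS.
rewrite coef_deriv coef_gamma_poly.
case: i => [|i]/=.
  by rewrite !bin0 big_geq//; ring.
by rewrite -[_ *+ i.+1]mulr_natr; ring.
Qed.

Lemma nuE a k (y : R) : y != 0 -> nu a k.+1 y = - (gamma_poly a k.+1).[y^-1].
Proof.
move=> y0; rewrite /nu (negbTE y0) horner_poly -sumrN mulr_sumr big_mkord.
by apply: eq_bigr => i _; rewrite exprVn /= exprS; ring.
Qed.
End gamma_poly.

Lemma measurable_horner_inv {R : realType} (q : {poly R}) (D : set R) :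
  open D -> (forall y, D y -> y != 0) ->
  measurable_fun D (fun y => - q.[y^-1]).
Proof.
move=> oD D0; apply: open_continuous_measurable_fun => // y /set_mem /D0 y0.
apply: cvgN; apply: (cvg_comp _ _ (cvgV y0 cvg_id)).
exact: continuous_horner.
Qed.

(** * Derivatives of the Gamma density *)

Section gamma_pdf_lemmas.
Context {R : realType}.
Implicit Types (a x : R) (k : nat).

Lemma gamma_pdf_gt0E a x : 0 < x ->
  gamma_pdf a x = (Gamma a)^-1 * x `^ (a - 1) * expR (- x).
Proof. by rewrite /gamma_pdf => ->. Qed.

Lemma gamma_pdf_le0E a x : x <= 0 -> gamma_pdf a x = 0.
Proof. by rewrite /gamma_pdf ltNge => ->. Qed.

Lemma Gamma_ge0 a : 0 <= Gamma a.
Proof.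
by apply: Rintegral_ge0 => t _; rewrite mulr_ge0 ?expR_ge0 ?powR_ge0.
Qed.

Lemma gamma_pdf_ge0 a x : 0 <= gamma_pdf a x.
Proof.
rewrite /gamma_pdf; case: ifPn => // _.
by rewrite !mulr_ge0 ?expR_ge0 ?powR_ge0// invr_ge0 Gamma_ge0.
Qed.

Lemma measurable_gamma_pdf a : measurable_fun [set: R] (gamma_pdf a).
Proof.
rewrite /gamma_pdf; apply: measurable_fun_ifT => //=.
  exact: measurable_fun_ltr.
apply: measurable_funM.
  by apply: measurable_funM => //; exact: measurable_powR.
exact: measurableT_comp.
Qed.

Lemma is_derive_gamma_pdf a x : 0 < x ->
  is_derive x 1 (gamma_pdf a) (gamma_pdf a x * ((a - 1) * x^-1 - 1)).
Proof.
move=> x0; apply: (@near_eq_is_derive _ _ _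
    (fun y => (Gamma a)^-1 *: (y `^ (a - 1) * expR (- y)))).
  near=> y; rewrite /GRing.scale/= mulrA gamma_pdf_gt0E//.
  by near: y; exact: lt_nbhsr.
have := is_derive1_powR (a - 1) x0 => dpow.
apply: is_derive_eq.
have -> : x `^ (a - 1 - 1) = x `^ (a - 1) / x.
  by rewrite powRB ?powRr1 ?ltW// (gt_eqF x0) ?implybT.
rewrite gamma_pdf_gt0E//.
rewrite /GRing.scale/=; ring.
Unshelve. all: by end_near. Qed.

Lemma is_derive_gamma_pdf_poly a (q : {poly R}) x : 0 < x ->
  is_derive x 1 (fun y => gamma_pdf a y * q.[y^-1])
    (gamma_pdf a x * (((a - 1) *: 'X - 1) * q - 'X ^+ 2 * q^`()).[x^-1]).
Proof.
move=> x0.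
have dp := is_derive_gamma_pdf a x x0.
have dV : is_derive x 1 (fun y : R => y^-1) (- x ^- 2).
  have x_neq0 : id x != 0 by rewrite gt_eqF.
  apply: is_derive_eq (is_deriveV x_neq0 (is_derive_id x 1)) _.
  by rewrite /GRing.scale/= mulr1.
have dq : is_derive x 1 (fun y => q.[y^-1]) (q^`().[x^-1] * - x ^- 2).
  exact: (@is_derive1_comp _ (horner q)).
apply: is_derive_eq.
have -> : (((a - 1) *: 'X - 1) * q - 'X ^+ 2 * q^`()).[x^-1] =
    ((a - 1) / x - 1) * q.[x^-1] - x ^- 2 * q^`().[x^-1].
  by rewrite !hornerE exprVn.
rewrite /GRing.scale/=; ring.
Qed.

Lemma derive1n_gamma_pdf_gt0 a k x : 0 < x ->
  (gamma_pdf a)^`(k)%classic x = gamma_pdf a x * (gamma_poly a k).[x^-1].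
Proof.
elim: k x => [|k IH] x x0; first by rewrite gamma_poly0 hornerE mulr1.
rewrite derive1nS derive1E gamma_polyS.
have [_ <-] := is_derive_gamma_pdf_poly a (gamma_poly a k) x x0.
apply: near_eq_derive; near=> y; apply: IH; near: y; exact: lt_nbhsr.
Unshelve. all: by end_near. Qed.

Lemma derivable_derive1n_gamma_pdf_gt0 a k x : 0 < x ->
  derivable (gamma_pdf a)^`(k)%classic x 1.
Proof.
move=> x0.
have [+ _] := is_derive_gamma_pdf_poly a (gamma_poly a k) x x0.
apply: near_eq_derivable; near=> y; apply/esym/derive1n_gamma_pdf_gt0.
by near: y; exact: lt_nbhsr.
Unshelve. all: by end_near. Qed.

Lemma is_derive_derive1n_gamma_pdf_lt0 a k x : x < 0 ->
  is_derive x 1 (gamma_pdf a)^`(k)%classic 0 /\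
  (gamma_pdf a)^`(k)%classic x = 0.
Proof.
elim: k x => [|k IH] x x0.
  split; last by rewrite derive1n0 gamma_pdf_le0E// ltW.
  apply: (@near_eq_is_derive _ _ _ (cst 0)).
  near=> y; rewrite /= gamma_pdf_le0E// ltW//; near: y; exact: lt_nbhsl.
split.
  apply: (@near_eq_is_derive _ _ _ (cst 0)).
  near=> y; rewrite derive1nS derive1E.
  have /IH[[_ ->]] // : y < 0. by near: y; exact: lt_nbhsl.
by rewrite derive1nS derive1E; have [[_ ->]] := IH _ x0.
Unshelve. all: by end_near. Qed.

(** * Behaviour at infinity and at the origin *)

Lemma inv_cvgy : (y^-1 : R) @[y --> +oo] --> 0.
Proof.
by apply/gtr0_cvgV0; [exact: nbhs_pinfty_gt|exact: cvg_id].
Qed.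

(** With n an integer above a - 1, the power y^(a - 1) is at most y^n for
    y >= 1, whereas exp y >= y^(n+1) / (n+1)!, so p(y) = O(1/y). *)
Lemma gamma_pdf_cvgy a : gamma_pdf a y @[y --> +oo] --> 0.
Proof.
pose n := (Num.truncn `|a|).+1.
have an : a - 1 <= n%:R.
  have : `|a| < n%:R by exact: truncnS_gt.
  by have := ler_norm a; lra.
pose C := (Gamma a)^-1 * (n.+1)`!%:R.
have CV0 : C * y^-1 @[y --> +oo] --> 0.
  by rewrite -[0](mulr0 C); apply: cvgM; [exact: cvg_cst|exact: inv_cvgy].
apply: (squeeze_cvgr _ (cvg_cst 0) CV0).
near=> y; rewrite gamma_pdf_ge0/=.
have y1 : 1 <= y by near: y; exact: nbhs_pinfty_ge.
have y0 : 0 < y by rewrite (lt_le_trans ltr01).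
rewrite gamma_pdf_gt0E// /C -!mulrA ler_wpM2l//.
  by rewrite invr_ge0 Gamma_ge0.
rewrite expRN ler_pdivlMr// mulrAC ler_pdivrMr ?expR_gt0//.
rewrite (@le_trans _ _ (y ^+ n * y))//.
  by rewrite ler_wpM2r ?(ltW y0)// -powR_mulrn ?(ltW y0)// ler_powR.
rewrite -exprSr mulrC -ler_pdivrMr ?ltr0n ?fact_gt0//.
by rewrite (le_trans _ (expR_ge1Dxn n _)) ?lerDr// ltW.
Unshelve. all: by end_near. Qed.

Lemma gamma_pdf_poly_cvgy a (q : {poly R}) :
  gamma_pdf a y * q.[y^-1] @[y --> +oo] --> 0.
Proof.
rewrite -[0](mul0r q.[0]); apply: cvgM; first exact: gamma_pdf_cvgy.
by apply: (cvg_comp _ _ inv_cvgy); exact: continuous_horner.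
Qed.

(** Term by term, q contributes powers y^(a - 2 - i) with i < size q, all of
    positive exponent. *)
Lemma gamma_pdf_poly_cvg0 a (q : {poly R}) : (size q).+1%:R < a ->
  y^-1 * (gamma_pdf a y * q.[y^-1]) @[y --> 0^'+] --> 0.
Proof.
move=> qa.
pose t (i : 'I_(size q)) y : R :=
  (Gamma a)^-1 * q`_i * (y `^ (a - i.+2%:R) * expR (- y)).
have t0 i : t i y @[y --> 0^'+] --> 0.
  have pow0 : y `^ (a - i.+2%:R) @[y --> (0 : R)^'+] --> 0.
    apply: powR_cvg0; rewrite subr_gt0 (le_lt_trans _ qa)// ler_nat.
    by rewrite !ltnS.
  have exp1 : expR (- y) @[y --> (0 : R)^'+] --> expR (- 0).
    apply: cvg_at_right_filter.
    by apply: (cvg_comp _ _ (cvgN cvg_id)); exact: continuous_expR.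
  have := cvgM (cvg_cst ((Gamma a)^-1 * q`_i)) (cvgM pow0 exp1).
  by rewrite mul0r mulr0; apply.
have : \sum_i t i y @[y --> 0^'+] --> 0.
  rewrite -[X in _ --> X](@big1 R 0 +%R _ (index_enum 'I_(size q)) xpredT
    (fun=> 0))//.
  by apply: (@cvg_big _ _ +%R) => [|i _]; [exact: add_continuous|exact: t0].
apply: cvg_trans; apply: near_eq_cvg; near=> y.
have y0 : 0 < y by near: y; exact: nbhs_right_gt.
rewrite gamma_pdf_gt0E// horner_coef !mulr_sumr; apply: eq_bigr => i _.
rewrite /t !powRB ?(gt_eqF y0) ?implybT// powR_mulrn ?(ltW y0)//.
rewrite powRr1 ?(ltW y0)//.
rewrite exprVn !exprS; set c := (Gamma a)^-1; have yN0 := lt0r_neq0 y0.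
by field; rewrite expf_neq0 yN0.
Unshelve. all: by end_near. Qed.

Lemma is_derive_at0 (f : R -> R) : f 0 = 0 -> (forall y, y < 0 -> f y = 0) ->
  y^-1 * f y @[y --> 0^'+] --> 0 -> is_derive (0 : R) 1 f 0.
Proof.
move=> f0 fN fP.
have : y^-1 * f y @[y --> 0^'] --> 0.
  apply: (@cvg_at_right_left_dnbhs _ R^o) => //.
  apply: cvg_near_cst.
  by near=> y; rewrite fN ?mulr0//; near: y; exact: nbhs_left_lt.
have -> : (fun y => y^-1 * f y) =
    (fun h => h^-1 *: ((f \o shift 0) (h *: 1) - f 0)).
  by apply/funext => y; rewrite /= f0 subr0 addr0 /GRing.scale/= mulr1.
by move=> fl; split; [exact: cvgP fl|exact: cvg_lim fl].
Unshelve. all: by end_near. Qed.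

(** Smoothness at 0 is gained one order at a time: differentiability of the j-th
    derivative at 0 needs its value there to be 0, and provides the same value
    for the next one. The first conclusion is therefore carried along. *)
Lemma derive1n_gamma_pdf0 a k : k.+1%:R < a ->
  (gamma_pdf a)^`(k)%classic 0 = 0 /\
  (k.+2%:R < a -> is_derive (0 : R) 1 (gamma_pdf a)^`(k)%classic 0).
Proof.
have step j : j.+2%:R < a -> (gamma_pdf a)^`(j)%classic 0 = 0 ->
    is_derive (0 : R) 1 (gamma_pdf a)^`(j)%classic 0.
  move=> ja p0; apply: is_derive_at0 => //.
    by move=> y /(is_derive_derive1n_gamma_pdf_lt0 a j)[].
  have : y^-1 * (gamma_pdf a y * (gamma_poly a j).[y^-1]) @[y --> 0^'+] --> 0.
    apply: gamma_pdf_poly_cvg0; rewrite (le_lt_trans _ ja)// ler_nat ltnS.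
    exact: size_poly.
  apply: cvg_trans; apply: near_eq_cvg; near=> y.
  by rewrite derive1n_gamma_pdf_gt0.
elim: k => [|k IH] ka.
  have p0 : (gamma_pdf a)^`(0)%classic 0 = 0.
    by rewrite derive1n0 gamma_pdf_le0E.
  by split => // /step; exact.
have ka' : k.+1%:R < a by rewrite (lt_trans _ ka)// ltr_nat.
have p0 : (gamma_pdf a)^`(k.+1)%classic 0 = 0.
  by rewrite derive1nS derive1E; have [_ /(_ ka)[_ ->]] := IH ka'.
by split => // /step; exact.
Unshelve. all: by end_near. Qed.

End gamma_pdf_lemmas.

(** * Expectations over upper and lower tails *)

Section expectations.
Context {R : realType} (a : R) {d : measure_display} {T : measurableType d}.
Context (P : probability T R) (G : {RV P >-> R}).
Hypothesis hG : has_density G (gamma_pdf a).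

(** Since - q_(k+1)(1/y) p(y) is the derivative of - q_k(1/y) p(y), which
    vanishes at infinity, its integral over ]x, +oo[ is q_k(1/x) p(x). *)
Lemma expectation_gamma_upper k x : 0 < x ->
  ('E_P[fun w => (\1_[set w | (x < G w)%R] w *
                  - (gamma_poly a k.+1).[(G w)^-1])%R] =
   (gamma_pdf a x * (gamma_poly a k).[x^-1])%:E)%E.
Proof.
move=> x0; set q := gamma_poly a k; set r := gamma_poly a k.+1.
have -> : [set w | x < G w] = G @^-1` `]x, +oo[.
  by apply/seteqP; split=> w /=; rewrite in_itv/= andbT.
pose f y := - r.[y^-1].
have pos y : `[x, +oo[%classic y -> 0 < y.
  by rewrite /= in_itv/= andbT; exact: lt_le_trans.
have sub : `]x, +oo[ `<=` `[x, +oo[ by apply: subset_itvr; rewrite bnd_simp.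
have mf : measurable_fun `[x, +oo[ f.
  apply: (@measurable_funS _ _ _ _ (`]0, +oo[%classic : set R)) => //.
    by move=> y /pos; rewrite /= in_itv/= andbT.
  apply: measurable_horner_inv => [|y /=]; first exact: interval_open.
  by rewrite in_itv/= andbT; exact: lt0r_neq0.
(* For y >= x the argument 1/y stays in the disk of radius 1/x. *)
have [M rM] := poly_disk_bound r x^-1.
have bf : [bounded f y | y in `[x, +oo[].
  exists M; split; first exact: num_real.
  move=> B MB y /[dup] /pos y0 /=; rewrite in_itv/= andbT => xy.
  rewrite /f normrN (le_trans _ (ltW MB))// rM//.
  by rewrite gtr0_norm ?invr_gt0// lef_pV2 ?posrE.
have mp := measurable_gamma_pdf a.
rewrite (expectation_density _ _ _ _ _ _ mp hG `]x, +oo[ f)//; last 2 first.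
- exact: measurable_funS mf.
- by case: bf => B [Br Bf]; exists B; split=> // C BC y /sub; exact: (Bf C BC).
have intp := density_integrable _ _ _ _ _ _ (gamma_pdf_ge0 a) mp hG.
have intf : lebesgue_measure.-integrable `[x, +oo[
    (EFin \o (fun y => f y * gamma_pdf a y)).
  have := @integrableMr _ _ _ lebesgue_measure `[x, +oo[ _ f
    (EFin \o gamma_pdf a).
  apply => //.
  exact: integrableS intp.
have dF y : x <= y -> is_derive y 1 (fun y => - (gamma_pdf a y * q.[y^-1]))
    (f y * gamma_pdf a y).
  move=> xy; have y0 : 0 < y by exact: lt_le_trans xy.
  rewrite /f /r gamma_polyS mulNr mulrC.
  by apply: is_deriveN; exact: is_derive_gamma_pdf_poly.
rewrite integral_itv_obnd_cbnd; last first.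
  by apply: measurable_funS (measurable_int _ intf).
rewrite (integrable_continuous_FTC2y _ _ _ 0 intf _ _ dF).
- by rewrite sub0e -EFinN opprK.
- apply: continuous_in_subspaceT => y /set_mem /pos y0.
  rewrite /f; apply: cvgM.
    apply: cvgN; apply: (cvg_comp _ _ (cvgV (lt0r_neq0 y0) cvg_id)).
    exact: continuous_horner.
  apply/differentiable_continuous/derivable1_diffP.
  by have [] := is_derive_gamma_pdf a y y0.
- by rewrite -oppr0; apply: cvgN; exact: gamma_pdf_poly_cvgy.
Qed.

(** The event G < x is null, so that even a pole of f at 0 is harmless. *)
Lemma expectation_gamma_lower (f : R -> R) (x : R) : x <= 0 ->
  measurable_fun `]-oo, x[ f ->
  ('E_P[fun w => (\1_[set w | (G w < x)%R] w * f (G w))%R] = 0)%E.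
Proof.
move=> x0 mf.
have -> : [set w | G w < x] = G @^-1` `]-oo, x[.
  by apply/seteqP; split=> w /=; rewrite in_itv.
have mG : measurable (G @^-1` `]-oo, x[).
  by rewrite -[X in measurable X]setTI; exact: measurable_funPT.
have PG0 : P (G @^-1` `]-oo, x[) = 0%E.
  rewrite -[LHS]/(distribution P G `]-oo, x[) hG//.
  apply: integral0_eq => y /=; rewrite in_itv/= => yx.
  by rewrite gamma_pdf_le0E// ltW// (lt_le_trans yx).
rewrite expectation.unlock.
transitivity (\int[P]_(w in G @^-1` `]-oo, x[) (f (G w))%:E)%E.
  rewrite [RHS]integral_mkcond; apply: eq_integral => w _.
  by rewrite patchE indicE; case: ifPn; rewrite (mul1r,mul0r).
apply: null_set_integral => //.
apply/measurable_EFinP; apply: (measurable_comp _ _ mf) => //.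
  by move=> _ [w Dw <-].
exact/measurable_funTS.
Qed.
End expectations.

(** * Representation of the density and of its derivatives *)

Theorem corollary3p4 (R : realType) (a : R) (ha : 0 < a)
    (d : measure_display) (T : measurableType d) (P : probability T R)
    (G : {RV P >-> R}) (hG : has_density G (gamma_pdf a)) :
  (forall x : R, 0 < x ->
     (gamma_pdf a x)%:E =
     ('E_P[fun w => (\1_[set w | x < G w] w * (1 + (1 - a) / G w))%R])%E) /\
  (forall x : R, x <= 0 ->
     (gamma_pdf a x)%:E =
     ('E_P[fun w => (\1_[set w | G w < x] w * (1 + (1 - a) / G w))%R])%E) /\
  (forall k : nat, (1 <= k)%N ->
     (forall x : R, 0 < x ->
        derivable (gamma_pdf a)^`(k.-1)%classic x 1 /\
        ((gamma_pdf a)^`(k)%classic x)%:E =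
        ('E_P[fun w => (\1_[set w | x < G w] w * nu a k.+1 (G w))%R])%E) /\
     (forall x : R, x < 0 ->
        derivable (gamma_pdf a)^`(k.-1)%classic x 1 /\
        ((gamma_pdf a)^`(k)%classic x)%:E =
        ('E_P[fun w => (\1_[set w | G w < x] w * nu a k.+1 (G w))%R])%E) /\
     (k.+1%:R < a ->
        derivable (gamma_pdf a)^`(k.-1)%classic 0 1 /\
        ((gamma_pdf a)^`(k)%classic 0)%:E =
        ('E_P[fun w => (\1_[set w | G w < 0] w * nu a k.+1 (G w))%R])%E /\
        ('E_P[fun w => (\1_[set w | G w < 0] w * nu a k.+1 (G w))%R])%E = 0%E)).
Proof.
have coefE y : y != 0 -> 1 + (1 - a) / y = - (gamma_poly a 1).[y^-1].
  rewrite gamma_polyS gamma_poly0 -polyC1 derivC mulr1 mulr0 subr0 !hornerE.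
  by move=> _; ring.
(* Stated for any f that agrees with - q_(k+1)(1/y) off 0, so as to cover both
   nu, whose value at 0 is 0, and 1 + (1 - a) / y, whose value there is 1. *)
have upper (f : R -> R) k x : 0 < x ->
    (forall y, y != 0 -> f y = - (gamma_poly a k.+1).[y^-1]) ->
    ('E_P[fun w => (\1_[set w | (x < G w)%R] w * f (G w))%R] =
     (gamma_pdf a x * (gamma_poly a k).[x^-1])%:E)%E.
  move=> x0 fE; rewrite -(expectation_gamma_upper a P G hG)//.
  congr ('E_P[_])%E.
  apply/funext => w; rewrite !indicE.
  have [/set_mem/= xG|_] := boolP (w \in _); last by rewrite !mul0r.
  by rewrite !mul1r fE// gt_eqF// (lt_trans x0).
have lower (f : R -> R) k x : x <= 0 ->
    (forall y, y != 0 -> f y = - (gamma_poly a k.+1).[y^-1]) ->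
    ('E_P[fun w => (\1_[set w | (G w < x)%R] w * f (G w))%R] = 0)%E.
  move=> x0 fE; apply: (expectation_gamma_lower a P G hG) => //.
  apply: eq_measurable_fun (measurable_horner_inv (gamma_poly a k.+1) _ _ _).
  - move=> y /set_mem /=; rewrite in_itv/= => yx.
    by rewrite fE// lt_eqF// (lt_le_trans yx).
  - exact: interval_open.
  - by move=> y /=; rewrite in_itv/= => yx; rewrite lt_eqF// (lt_le_trans yx).
split.
  move=> x x0; rewrite (upper (fun y => 1 + (1 - a) / y) 0)//.
  by rewrite gamma_poly0 hornerE mulr1.
split.
  by move=> x x0; rewrite (lower (fun y => 1 + (1 - a) / y) 0)// gamma_pdf_le0E.
case=> // k _; split; [|split].
- move=> x x0; split; first exact: derivable_derive1n_gamma_pdf_gt0.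
  rewrite derive1n_gamma_pdf_gt0// (upper (nu a k.+2) k.+1)// => y.
  exact: nuE.
- move=> x x0.
  have [dk _] := is_derive_derive1n_gamma_pdf_lt0 a k x x0.
  split; first by case: dk.
  have [_ ->] := is_derive_derive1n_gamma_pdf_lt0 a k.+1 x x0.
  rewrite (lower (nu a k.+2) k.+1) ?ltW// => y.
  exact: nuE.
- move=> ka.
  have E0 := lower (nu a k.+2) k.+1 0 (lexx _) (nuE a k.+1).
  rewrite E0; split; last split => //.
    have [|_ /(_ ka)[]//] := derive1n_gamma_pdf0 a k.
    by rewrite (lt_trans _ ka)// ltr_nat.
  by have [->] := derive1n_gamma_pdf0 a k.+1 ka.
Qed.
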